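(* Let $N\in\mathbb{N}_{+}$ and let $e\in\mathcal{E}\subset\mathcal{L}^{I}$ be an exciting function with support on $[0,N\tau)\subset I$. Let $F:\mathcal{E}\to\mathcal{E}$ be an $\alpha$-passive causal function. If $g\in\mathcal{L}^{I}$ is a process such that $g(t)\equiv 0$ for $t\leqslant 0$ and $$g(t+\tau)=F[\,e+g\,](t)\qquad\text{for } t=n\tau,\ n\in\mathbb{N},$$ then $g$ is uniquely defined (modulo $\mu$), and for every $t\geqslant N\tau$ $$\|g(t)\|\;\leqslant\; a+\Bigl(\frac{b}{\tau}\int_{[0,N\tau)}\bigl(\alpha(e+g)-\alpha(g)\bigr)\,d\mu\Bigr)^{c}$$ for all non-negative real constants $a,b,c$ that satisfy $\|z\|\leqslant a+b\,(\alpha(z))^{c}$ for every $z\in\mathcal{L}$. Hence $g$ is stable.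
   Context: $\mathcal{L}$ is a real or complex linear space with a norm $\|\cdot\|$. $\tau>0$ is a real number. Either $I=\mathbb{R}$ with the measure $\mu$ concentrated on $\{k\tau\mid k\in\mathbb{Z}\}$ with $\mu(\{k\tau\})=\tau$ for each $k\in\mathbb{Z}$, or $I=\{k\tau\mid k\in\mathbb{Z}\}$ with the same weights $\mu(\{k\tau\})=\tau$. Functions on $I$ are read modulo $\mu$ (as equivalence classes of functions differing at most on a set of $\mu$-measure zero). Intervals such as $[0,N\tau)$ are intervals in $I$. $\alpha:\mathcal{L}\to\mathbb{R}$ is a continuous non-negative functional which is delimiting, i.e. there exist non-negative real constants $a,b,c$ with $\|z\|\leqslant a+b\,(\alpha(z))^{c}$ for every $z\in\mathcal{L}$ (then necessarily $b,c>0$). $\mathcal{E}\subset\mathcal{L}^{I}$ is a set of functions such that: for every $f\in\mathcal{E}$ and $t\in I$ the truncated function $\chi_{s\leqslant t}(s)f(s)$ (equal to $f(s)$ for $s\leqslant t$ and $0$ for $s>t$) belongs to $\mathcal{E}$; $\mathcal{E}$ is closed under the shift $f(t)\mapsto f(t-\tau)$; and $\alpha\circ f$ is $\mu$-summable over finite intervals in $I$ for every $f\in\mathcal{E}$. The set $\mathcal{E}$ is not assumed to be a linear space. A function $F:\mathcal{E}\to\mathcal{E}$ (not necessarily linear) is causal iff for every $f\in\mathcal{E}$ and $t\in I$, $(Ff)(t)=\bigl(F[\chi_{s\leqslant t}f(s)]\bigr)(t)$. A causal function $F:\mathcal{E}\to\mathcal{E}$ is $\alpha$-passive iff for every $f\in\mathcal{E}$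 and $t\in I$, $$\int_{s<t}\alpha\bigl((Ff)(s)\bigr)\,d\mu(s)\leqslant\int_{s<t}\alpha\bigl(f(s)\bigr)\,d\mu(s).$$ A process $g:I\to\mathcal{L}$ is stable iff it is uniformly bounded on $I$, i.e. there is $B\in\mathbb{R}_{+}$ with $\|g(t)\|<B$ for every $t\in I$. In the recursion, the existence of $g$ is not claimed; it is part of the hypothesis that the expression $F[e+g](t)$ makes sense: by causality it involves $e+g$ only up to time $t$, i.e. only the truncation $\chi_{s\leqslant t}(e+g)$, which is understood to lie in $\mathcal{E}$.
   Formalization: The bound is proved as a + b((1/τ)∫(α(e+g)−α(g))dμ)^c, with b outside the power, as the printed form fails e.g. for α(z)=z²/4, (a,b,c)=(0,2,1/2); and α(0)=0 is assumed, since otherwise the passivity integrals over the infinite past are infinite and the claim fails. *)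

(* Defs.v *)
From HB Require Import structures.
From mathcomp Require Import all_boot all_order all_algebra.
From mathcomp Require Import complex.
From mathcomp Require Import all_classical all_reals all_analysis.

Set Implicit Arguments.
Unset Strict Implicit.
Unset Printing Implicit Defensive.

Import Order.TTheory GRing.Theory Num.Theory.
Import numFieldNormedType.Exports.

Local Open Scope classical_set_scope.
Local Open Scope ring_scope.

(* The normed space is over R or over R[i].  In the second case the library's
   norm takes its (real) values in R[i], and [rnorm] brings them back to R. *)
Inductive scalars := RealScalars | ComplexScalars.

Definition scalar_field (R : realType) (k : scalars) : numFieldType :=
  match k with RealScalars => R | ComplexScalars => R[i]%C end.

Definition scalar_re (R : realType) (k : scalars) : scalar_field R k -> R :=
  match k with RealScalars => id | ComplexScalars => @complex.Re R end.

Definition rnorm (R : realType) (k : scalars)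
  (L : normedModType (scalar_field R k)) (z : L) : R := scalar_re `|z|.

(* A copy of R in which every subset is measurable: the measure below is
   purely atomic, so it is defined on all subsets, and no measurability
   condition falls on the functions of time. *)
Definition axis (R : realType) : Type := R.

HB.instance Definition _ (R : realType) := Pointed.on (axis R).
HB.instance Definition _ (R : realType) :=
  @isMeasurable.Build default_measure_display (axis R) discrete_measurable
    discrete_measurable0 discrete_measurableC discrete_measurableU.

Section Time.
Context (R : realType) (tau : {posnum R}).

Definition grid : set (axis R) := range (fun k : int => k%:~R * tau%:num).

Lemma measurable_grid : measurable grid. Proof. by []. Qed.

Definition mu : {measure set (axis R) -> \bar R} :=
  mscale tau%:num%:nng (mrestr (@counting (axis R) R) measurable_grid).

Lemma mu_atom (k : int) : mu [set k%:~R * tau%:num] = (tau%:num)%:E.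
Proof.
rewrite /mu /= /mscale /= /mrestr setIidl; last by move=> _ ->; exists k.
rewrite /counting asboolT; last exact: finite_set1.
by rewrite fset_set1 finmap.cardfs1 mule1.
Qed.

Lemma mu_setC_grid : mu (~` grid) = 0%E.
Proof. by rewrite /mu /= /mscale /= /mrestr setICl measure0 mule0. Qed.

(* A function on I is represented by a function on R.  As functions are read
   modulo mu and mu (R \ grid) = 0, this serves both for I = R and for
   I = grid, the values taken outside of I being irrelevant. *)
Definition time_domain (I : set R) : Prop := I = [set: R] \/ I = grid.

Definition ae_time (I : set R) (P : R -> Prop) : Prop :=
  {ae mu, forall t : axis R, I t -> P t}.

Definition eq_mod_mu (I : set R) (T : Type) (f g : R -> T) : Prop :=
  ae_time I (fun t => f t = g t).

Section Functions.
Context (L : zmodType) (I : set R) (alpha : L -> R).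
Implicit Types (f g h e : R -> L) (E : set (R -> L)) (F : (R -> L) -> R -> L).

Definition truncate (t : R) f : R -> L := fun s => if s <= t then f s else 0.

(* A set of classes modulo mu is a saturated set of representatives. *)
Definition saturated E : Prop :=
  forall f g, E f -> eq_mod_mu I f g -> E g.

Definition admissible E : Prop :=
  [/\ saturated E,
      forall f t, E f -> I t -> E (truncate t f),
      forall f, E f -> E (fun t => f (t - tau%:num)) &
      forall f (x y : R), E f -> mu.-integrable (I `&` `[x, y])
                                  (fun s => (alpha (f s))%:E)].

(* F acts on the classes modulo mu of the elements of E. *)
Definition self_map E F : Prop :=
  (forall f, E f -> E (F f)) /\
  (forall f g, E f -> E g -> eq_mod_mu I f g -> eq_mod_mu I (F f) (F g)).

(* The truncation time varies with the point of evaluation, so the equality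
   of values at t is required for mu-almost every t, not for each t: a class
   modulo mu has no value at a point outside of the grid. *)
Definition causal E F : Prop :=
  forall f, E f -> ae_time I (fun t => F f t = F (truncate t f) t).

(* The integrals may be infinite, and the inequality then holds trivially.
   When alpha 0 > 0 this is the case for every process which vanishes for all
   negative times, and passivity says nothing about such processes. *)
Definition passive E F : Prop :=
  forall f t, E f -> I t ->
    (\int[mu]_(s in I `&` `]-oo, t[) (alpha (F f s))%:E <=
     \int[mu]_(s in I `&` `]-oo, t[) (alpha (f s))%:E)%E.

Definition supported_in (A : set R) e : Prop :=
  ae_time I (fun t => ~ A t -> e t = 0).

(* [F h t] for a process h which need not be in E itself: by causality only
   the truncation of h at t matters, and it is this truncation which has to
   be in E for the expression to make sense. *)
Definition feedback_process E F e g : Prop :=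
  ae_time I (fun t => t <= 0 -> g t = 0) /\
  forall n : nat, let t := n%:R * tau%:num in
    E (truncate t (fun s => e s + g s)) /\
    g (t + tau%:num) = F (truncate t (fun s => e s + g s)) t.

End Functions.

Section Normed.
Context (k : scalars) (L : normedModType (scalar_field R k)).

(* x `^ 0 = 1 for all x, 0 included. *)
Definition delimits (alpha : L -> R) (a b c : R) : Prop :=
  [/\ 0 <= a, 0 <= b, 0 <= c & forall z : L, rnorm z <= a + b * alpha z `^ c].

Definition delimiting (alpha : L -> R) : Prop :=
  exists a b c : R, delimits alpha a b c.

Definition stable (I : set R) (g : R -> L) : Prop :=
  exists2 B : R, 0 < B & ae_time I (fun t => rnorm (g t) < B).

End Normed.
End Time.

(* Main.v *)
Require Import Defs.
From mathcomp Require Import all_boot all_order all_algebra.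
From mathcomp Require Import all_classical all_reals all_analysis.
From mathcomp Require Import complex.
Set Implicit Arguments.
Unset Strict Implicit.
Unset Printing Implicit Defensive.
Import Order.TTheory GRing.Theory Num.Theory.
Import numFieldNormedType.Exports.
Local Open Scope classical_set_scope.
Local Open Scope ring_scope.

(** The measure is purely atomic, with an atom of mass tau at each k tau, so
    that everything takes place in discrete time: an assertion holds almost
    everywhere when it holds at each k tau ([ae_timeP]), and the integral over
    [0, n tau[ is tau times a sum of n values.  Write h := e + g and h_n for its
    truncation at n tau.

    Uniqueness is a strong induction on n: two solutions that agree up to n tau
    have the same h_n modulo mu, hence the same F h_n at the atom n tau, which
    is the value of both at (n + 1) tau ([feedback_unique]).

    For the bound, the crucial point is that one single input, h_n, produces
    all the values g (tau), ..., g ((n + 1) tau): by causality, F h_n at j tau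
    is F h_j at j tau when j <= n ([feedback_past_output]).  Since h vanishes at
    negative times and alpha 0 = 0, the passivity of F on the input h_n up to
    time (n + 1) tau then gives ([feedback_energy_le])

      sum_(k < n + 1) alpha (g ((k + 1) tau)) <= sum_(k < n + 1) alpha (h (k tau)).

    The left-hand side is the sum of the alpha (g (k tau)) shifted by one step,
    and h = g from time N tau on.  So with M = n + 1 >= N all the terms between
    N and M cancel, and what remains is an estimate of the last value of g by
    the energy exchanged during the excitation ([feedback_energy_bound]):

      alpha (g (M tau)) <= sum_(k < N) (alpha (h (k tau)) - alpha (g (k tau))).

    The right-hand side no longer depends on M, and the delimiting inequality
    turns it into a uniform bound on the norm of g. *)

(** * The norm and the measure *)

Lemma rnorm_ge0 (R : realType) (k : scalars)
  (L : normedModType (scalar_field R k)) (z : L) : 0 <= rnorm z.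
Proof.
rewrite /rnorm; have := normr_ge0 z.
case: k L z => L z /=; first by [].
by rewrite lecE => /andP[].
Qed.

Lemma measurable_axis (R : realType) (D : set (axis R)) : measurable D.
Proof. by []. Qed.

Section GridTime.
Context (R : realType) (tau : {posnum R}) (I : set R)
  (hI : time_domain tau I).

Lemma grid_time (k : int) : I (k%:~R * tau%:num).
Proof. by case: hI => ->//; exists k. Qed.

Lemma grid_time_nat (n : nat) : I (n%:R * tau%:num).
Proof. exact: (grid_time n). Qed.

(** A null set contains no atom, as each has mass tau > 0, and the complement
    of the grid is null. *)
Lemma ae_timeP (P : R -> Prop) :
  ae_time tau I P <-> forall k : int, P (k%:~R * tau%:num).
Proof.
split=> [[A [mA A0 PA]] k | PI].
- apply: contrapT => nP.
  have kA : [set k%:~R * tau%:num : axis R] `<=` A.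
    by move=> _ ->; apply: PA => /(_ (grid_time k)).
  have : (mu tau [set (k%:~R * tau%:num)%R] <= mu tau A)%E.
    by apply: le_measure => //; rewrite inE; exact: measurable_axis.
  by rewrite A0 mu_atom lee_fin leNgt gt0.
- exists (~` grid tau); split=> [//||t nPt [k _ kt]]; first exact: mu_setC_grid.
  by apply: nPt => _; rewrite -kt.
Qed.

Lemma ge0_integral_grid (D : set (axis R)) (f : axis R -> \bar R) :
  (forall s, (0 <= f s)%E) ->
  (\int[mu tau]_(s in D) f s = \int[mu tau]_(s in D `&` grid tau) f s)%E.
Proof.
move=> f0; rewrite (@ge0_negligible_integral _ _ _ (mu tau) D (~` grid tau))//.
  by rewrite setDE setCK.
exact: mu_setC_grid.
Qed.

(** By induction on n: the grid meets [n tau, (n + 1) tau[ in the single point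
    n tau, of mass tau. *)
Lemma ge0_integral_window (f : axis R -> R) (n : nat) : (forall s, 0 <= f s) ->
  (\int[mu tau]_(s in I `&` `[0%R, (n%:R * tau%:num)%R[) (f s)%:E =
   (tau%:num * \sum_(k < n) f (k%:R * tau%:num))%:E)%E.
Proof.
move=> f0; have fE0 s : (0 <= (f s)%:E)%E by rewrite lee_fin.
elim: n => [|n IHn].
  rewrite mul0r set_itvco0 setI0 integral_set0 big_ord0 mulr0//.
have nS : n%:R * tau%:num <= n.+1%:R * tau%:num.
  by rewrite ler_wpM2r// ler_nat.
have n0 : 0 <= n%:R * tau%:num by rewrite mulr_ge0.
have -> : I `&` `[0%R, (n.+1%:R * tau%:num)%R[ =
    (I `&` `[0%R, (n%:R * tau%:num)%R[) `|`
    (I `&` `[(n%:R * tau%:num)%R, (n.+1%:R * tau%:num)%R[).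
  rewrite -setIUr; congr (_ `&` _); apply/seteqP; split=> s /=; rewrite !in_itv/=.
    move=> /andP[s0 sn]; case: (ltP s (n%:R * tau%:num)) => h.
      by left; apply/andP.
    by right; apply/andP.
  case=> /andP[h1 h2]; apply/andP; split=> //.
    exact: lt_le_trans h2 nS.
  exact: le_trans n0 h1.
rewrite ge0_integral_setU//; last first.
  apply/disj_setPS => s [[_ /=] + [_ /=]]; rewrite !in_itv/= => /andP[_ h] /andP[h' _].
  by have := lt_le_trans h h'; rewrite ltxx.
rewrite IHn big_ord_recr/= mulrDr EFinD; congr (_ + _)%E.
rewrite ge0_integral_grid//.
have -> : (I `&` `[(n%:R * tau%:num)%R, (n.+1%:R * tau%:num)%R[) `&` grid tau =
    [set n%:R * tau%:num : axis R].
  apply/seteqP; split=> s /=.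
    move=> [[_]] /[swap] -[k _ <-]; rewrite in_itv/= => /andP[].
    rewrite ler_pM2r// ltr_pM2r// -[n%:R]/((n%:Z)%:~R) -[n.+1%:R]/((n.+1%:Z)%:~R).
    rewrite ler_int ltr_int => h1 h2.
    suff -> : k = n%:Z by [].
    by apply/eqP; rewrite eq_le h1 -ltzD1 addrC -intS h2.
  move=> ->; split; last by exists n%:Z.
  split; first exact: grid_time_nat.
  by rewrite /= in_itv/= lexx ltr_pM2r// ltr_nat/=.
rewrite (eq_integral (cst (f (n%:R * tau%:num))%:E)); last first.
  by move=> s; rewrite inE => ->.
by rewrite integral_cst// (mu_atom tau n) -EFinM mulrC.
Qed.

Lemma past_split (n : nat) : I `&` `]-oo, (n%:R * tau%:num)[ =
  (I `&` `]-oo, 0[) `|` (I `&` `[0, n%:R * tau%:num[).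
Proof.
rewrite -setIUr; congr (_ `&` _); apply/seteqP; split=> s /=; rewrite !in_itv/=.
  by move=> sn; case: (ltP s 0) => h; [left | right].
case=> [s0|/andP[]//]; apply: lt_le_trans s0 _; exact: mulr_ge0.
Qed.

(** The integral on the left of passivity runs over the whole past, where
    nothing is known of the output at negative times; for a lower bound they can
    be dropped, the integrand being non-negative. *)
Lemma integral_past_ge (f : axis R -> R) (n : nat) : (forall s, 0 <= f s) ->
  ((tau%:num * \sum_(k < n) f (k%:R * tau%:num))%:E <=
   \int[mu tau]_(s in I `&` `]-oo, (n%:R * tau%:num)%R[) (f s)%:E)%E.
Proof.
move=> f0; rewrite -ge0_integral_window//.
apply: ge0_subset_integral => // [s _|]; first by rewrite lee_fin.
rewrite past_split; exact: subsetUr.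
Qed.

(** The integral on the right of passivity has to be exact, and therefore
    finite: this is where the input must have no energy at negative times. *)
Lemma integral_past (f : axis R -> R) (n : nat) : (forall s, 0 <= f s) ->
  (forall k : int, k < 0 -> f (k%:~R * tau%:num) = 0) ->
  (\int[mu tau]_(s in I `&` `]-oo, (n%:R * tau%:num)%R[) (f s)%:E =
   (tau%:num * \sum_(k < n) f (k%:R * tau%:num))%:E)%E.
Proof.
move=> f0 fneg; have fE0 s : (0 <= (f s)%:E)%E by rewrite lee_fin.
rewrite past_split ge0_integral_setU//; last first.
  apply/disj_setPS => s [[_ /=] + [_ /=]]; rewrite !in_itv/= => h /andP[h' _].
  by have := lt_le_trans h h'; rewrite ltxx.
rewrite ge0_integral_window// ge0_integral_grid// integral0_eq ?add0e//.
move=> s [[_ /=] + [k _ ks]]; rewrite in_itv/= -ks pmulr_llt0// ltrz0 => k0.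
by rewrite fneg.
Qed.

Lemma Rintegral_window_sub (f h : axis R -> R) (n : nat) :
  (forall s, 0 <= f s) -> (forall s, 0 <= h s) ->
  \int[mu tau]_(s in I `&` `[0%R, (n%:R * tau%:num)%R[) (f s - h s) =
  tau%:num * (\sum_(k < n) f (k%:R * tau%:num) - \sum_(k < n) h (k%:R * tau%:num)).
Proof.
move=> f0 h0.
have fin u : (forall s, 0 <= u s) ->
    (mu tau).-integrable (I `&` `[0%R, (n%:R * tau%:num)%R[) (EFin \o u).
  move=> u0; apply/integrableP; split=> //.
  under eq_integral do rewrite /= ger0_norm//.
  by rewrite ge0_integral_window// ltry.
rewrite RintegralB//; [|exact: fin..].
by rewrite /Rintegral !ge0_integral_window//= mulrBr.
Qed.

(** * The feedback loop *)

Section Loop.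
Context (L : zmodType).
Implicit Types (f e g h : R -> L) (E : set (R -> L)) (F : (R -> L) -> R -> L).

Lemma truncate_truncate (s t : R) h : s <= t ->
  truncate s (truncate t h) = truncate s h.
Proof.
move=> st; apply/funext => x; rewrite /truncate.
by case: ifP => // xs; rewrite (le_trans xs st).
Qed.

Lemma ler_grid (j k : int) :
  (j%:~R * tau%:num <= k%:~R * tau%:num) = (j <= k).
Proof. by rewrite ler_pM2r// ler_int. Qed.

Lemma feedback_nonpos E F e g (k : int) : feedback_process tau I E F e g ->
  k <= 0 -> g (k%:~R * tau%:num) = 0.
Proof.
by case=> /ae_timeP + _ k0; apply; rewrite pmulr_lle0// lerz0.
Qed.

Lemma feedback_succ E F e g (n : nat) : feedback_process tau I E F e g ->
  g (n.+1%:R * tau%:num) =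
  F (truncate (n%:R * tau%:num) (fun s => e s + g s)) (n%:R * tau%:num).
Proof. by case=> _ /(_ n)[_ /= <-]; rewrite -natr1 mulrDl mul1r. Qed.

(** The past determines the next value; the map F being defined modulo mu
    only, this uses that its value at an atom is well defined. *)
Lemma feedback_unique E F e g g' : self_map tau I E F ->
  feedback_process tau I E F e g -> feedback_process tau I E F e g' ->
  eq_mod_mu tau I g' g.
Proof.
move=> [_ Fmod] hg hg'; apply/ae_timeP.
have nonpos (k : int) : k <= 0 -> g' (k%:~R * tau%:num) = g (k%:~R * tau%:num).
  by move=> k0; rewrite (feedback_nonpos hg)// (feedback_nonpos hg').
suff nat_eq n : g' (n%:R * tau%:num) = g (n%:R * tau%:num).
  by case=> n; [exact: nat_eq | exact: nonpos].
elim/ltn_ind: n => -[_|n IHn]; first exact: (nonpos 0).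
rewrite (feedback_succ _ hg) (feedback_succ _ hg').
case: hg hg' => [_ /(_ n)[Eg _]] [_ /(_ n)[Eg' _]].
have := (ae_timeP _).1 (Fmod _ _ Eg' Eg _) n; apply.
apply/ae_timeP => -[j|j]; rewrite /truncate; case: ifP => //.
  by rewrite (ler_grid j n) => jn; rewrite IHn.
by rewrite nonpos.
Qed.

(** Truncating the input at n tau does not change the outputs up to that time,
    so a single element of E carries the whole history of the loop and
    passivity can be applied to it once. *)
Lemma feedback_past_output E F e g (j n : nat) : causal tau I E F ->
  feedback_process tau I E F e g -> (j <= n)%N ->
  F (truncate (n%:R * tau%:num) (fun s => e s + g s)) (j%:R * tau%:num) =
  g (j.+1%:R * tau%:num).
Proof.
move=> cF hg jn; have [_ /(_ n)[En _]] := hg.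
have -> := (ae_timeP _).1 (cF _ En) j.
rewrite truncate_truncate ?(feedback_succ _ hg)//.
by rewrite (ler_grid j n).
Qed.

(** Passivity of F for the input truncated at its last time (n - 1) tau, read
    at time n tau: the output of the loop is the process one step later. *)
Lemma feedback_energy_le E F e g (alpha : L -> R) (n : nat) :
  (forall z, 0 <= alpha z) -> alpha 0 = 0 ->
  causal tau I E F -> passive tau I alpha E F ->
  feedback_process tau I E F e g ->
  (forall k : int, k < 0 -> e (k%:~R * tau%:num) = 0) ->
  \sum_(k < n) alpha (g (k.+1%:R * tau%:num)) <=
  \sum_(k < n) alpha (e (k%:R * tau%:num) + g (k%:R * tau%:num)).
Proof.
move=> a0 a00 cF pF hg eneg.
case: n => [|n]; first by rewrite !big_ord0.
have [_ /(_ n)[En _]] := hg.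
have := pF _ _ En (grid_time_nat n.+1).
move=> /(le_trans (integral_past_ge _ (fun s => a0 _))).
rewrite (integral_past (f := fun s => alpha _))//; last first.
  move=> k k0; rewrite /truncate; case: ifP => //= _.
  by rewrite eneg// (feedback_nonpos hg (ltW k0)) addr0.
rewrite lee_fin ler_pM2l//.
under eq_bigr => j _ do rewrite (feedback_past_output (j := j) (n := n) cF hg (ltn_ord j)).
under [X in _ <= X -> _]eq_bigr => j _.
  rewrite /truncate (ler_grid j n) lez_nat (ltn_ord j : (j <= n)%N).
  over.
by [].
Qed.

(** The two sums of [feedback_energy_le] telescope: after N tau the input of F
    is g itself, so only the last value of g survives on the left and only the
    excitation interval on the right. *)
Lemma feedback_energy_bound E F e g (alpha : L -> R) (N M : nat) :
  (forall z, 0 <= alpha z) -> alpha 0 = 0 ->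
  causal tau I E F -> passive tau I alpha E F ->
  feedback_process tau I E F e g ->
  supported_in tau I `[0, N%:R * tau%:num[ e -> (N <= M)%N ->
  alpha (g (M%:R * tau%:num)) <=
  tau%:num^-1 * \int[mu tau]_(s in I `&` `[0%R, (N%:R * tau%:num)%R[)
                  (alpha (e s + g s) - alpha (g s)).
Proof.
move=> a0 a00 cF pF hg /ae_timeP e0 NM.
have eneg (k : int) : k < 0 -> e (k%:~R * tau%:num) = 0.
  move=> k0; apply: e0; rewrite /= in_itv/= pmulr_lge0// ler0z leNgt k0.
  by [].
have elate (k : nat) : (N <= k)%N -> e (k%:R * tau%:num) = 0.
  move=> Nk; apply: (e0 k%:Z); rewrite /= in_itv/= => /andP[_].
  by rewrite ltNge (ler_grid N k) lez_nat Nk.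
rewrite Rintegral_window_sub// mulKf//.
have := feedback_energy_le M a0 a00 cF pF hg eneg.
have g0 : alpha (g (0%:R * tau%:num)) = 0 by rewrite (feedback_nonpos (k:=0) hg).
(* shift the sum by one step, using that g vanishes at time 0 *)
have -> : \sum_(k < M) alpha (g (k.+1%:R * tau%:num)) =
    \sum_(k < M) alpha (g (k%:R * tau%:num)) + alpha (g (M%:R * tau%:num)).
  have /= <- := big_ord_recr M (fun k : 'I_M.+1 => alpha (g (k%:R * tau%:num))).
  by rewrite big_ord_recl g0 /= add0r.
rewrite -lerBrDl => /le_trans; apply.
rewrite -(subnKC NM) !big_split_ord/= opprD addrACA gerDl.
rewrite -sumrB big1// => k _.
by rewrite elate ?leq_addr// add0r subrr.
Qed.

End Loop.
End GridTime.

(** * Boundedness of the process *)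

Theorem theorem1 (R : realType) (k : scalars)
  (L : normedModType (scalar_field R k)) (tau : {posnum R}) (I : set R)
  (alpha : L -> R) (E : set (R -> L)) (F : (R -> L) -> R -> L)
  (N : nat) (e g : R -> L)
  (hI : time_domain tau I)
  (alpha_continuous : continuous alpha)
  (alpha_ge0 : forall z, 0 <= alpha z)
  (alpha_delimiting : delimiting alpha)
  (alpha0 : alpha 0 = 0)
  (hE : admissible tau I alpha E)
  (hF : self_map tau I E F)
  (F_causal : causal tau I E F)
  (F_passive : passive tau I alpha E F)
  (N_gt0 : (0 < N)%N)
  (Ee : E e)
  (e_supp : supported_in tau I `[0, N%:R * tau%:num[ e)
  (hg : feedback_process tau I E F e g) :
  [/\ forall g' : R -> L, feedback_process tau I E F e g' ->
        eq_mod_mu tau I g' g,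
      forall a b c : R, delimits alpha a b c ->
        ae_time tau I (fun t => N%:R * tau%:num <= t ->
          rnorm (g t) <= a + b *
            (tau%:num^-1 *
             \int[mu tau]_(s in I `&` `[0%R, (N%:R * tau%:num)%R[)
               (alpha (e s + g s) - alpha (g s))) `^ c) &
      stable tau I g].
Proof.
have bound a b c : delimits alpha a b c -> forall M : nat, (N <= M)%N ->
    rnorm (g (M%:R * tau%:num)) <= a + b *
      (tau%:num^-1 * \int[mu tau]_(s in I `&` `[0%R, (N%:R * tau%:num)%R[)
         (alpha (e s + g s) - alpha (g s))) `^ c.
  move=> [_ b0 c0 delim] M NM; apply: le_trans (delim _) _.
  have le_energy := feedback_energy_bound hI alpha_ge0 alpha0 F_causal F_passive
                      hg e_supp NM.
  rewrite lerD2l ler_wpM2l// ge0_ler_powR// nnegrE; first exact: alpha_ge0.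
  exact: le_trans (alpha_ge0 _) le_energy.
split=> [g' hg'|a b c abc|].
- exact: (feedback_unique hI hF hg hg').
- apply/ae_timeP => // j; rewrite -[N%:R]/((N%:Z)%:~R) ler_grid.
  by case: j => // M; exact: bound.
- have [a [b [c /bound]]] := alpha_delimiting.
  set C := (X in forall M, _ -> _ <= X) => late.
  (* the finitely many values on [0, N tau[ are bounded by their sum *)
  pose S := \sum_(k < N) rnorm (g (k%:R * tau%:num)).
  have S0 : 0 <= S by apply: sumr_ge0 => *; exact: rnorm_ge0.
  have C0 : 0 <= C by exact: le_trans (rnorm_ge0 _) (late N _).
  have early M : (M < N)%N -> rnorm (g (M%:R * tau%:num)) <= S.
    move=> MN; rewrite /S (bigD1 (Ordinal MN))//= lerDl.
    by apply: sumr_ge0 => *; exact: rnorm_ge0.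
  exists (S + C + 1); first by rewrite ltr_wpDl// addr_ge0.
  apply/ae_timeP => // -[n|n]; apply: ltr_pwDr => //.
    case: (ltnP n N) => nN.
      by apply: le_trans (early n nN) _; rewrite lerDl.
    by apply: le_trans (late n nN) _; rewrite lerDr.
  (* 0 is also the value at time 0, one of the terms of S as N > 0 *)
  rewrite (feedback_nonpos hI hg)// -(feedback_nonpos (k := 0) hI hg)//.
  by apply: le_trans (early 0%N N_gt0) _; rewrite lerDl.
Qed.
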